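(* Let $T=RT(a_1,\ldots,a_n)$ be a tree of diameter $4$ which is a lobster, where at least three of the $a_i$ are positive (i.e. $k+l\ge 3$ in the notation of the context). If $T$ has an even number of edges, then $T$ is super edge-graceful.
   Context: A lobster is a tree such that removing all its leaves leaves a caterpillar (a caterpillar being a tree whose removal of leaves leaves a path). For a finite simple graph $G$ with $p$ vertices and $q$ edges, $G$ is super edge-graceful if there is a bijection $f$ from $E(G)$ onto $\{0,\pm1,\ldots,\pm\frac{q-1}{2}\}$ when $q$ is odd, and onto $\{\pm1,\ldots,\pm\frac{q}{2}\}$ when $q$ is even, such that the induced vertex labeling $f^+(v)=\sum_{uv\in E(G)} f(uv)$ is a bijection from $V(G)$ onto $\{0,\pm1,\ldots,\pm\frac{p-1}{2}\}$ when $p$ is odd, and onto $\{\pm1,\ldots,\pm\frac{p}{2}\}$ when $p$ is even. For nonnegative integers $a_1,\ldots,a_n$, $RT(a_1,\ldots,a_n)$ is the rooted tree with root $v_0$, children $v_1,\ldots,v_n$ of $v_0$, where $v_i$ has exactly $a_i$ children, all leaves. Let $j$, $k$, $l$ be respectively the number of indices $i$ with $a_i=0$, with $a_i>0$ even, and with $a_i$ odd, so $n=j+k+l$. Every tree of diameter $4$ is of the form $RT(a_1,\ldots,a_n)$ with $k+l\ge2$. *)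

(* Defs.v *)
From mathcomp Require Import all_boot all_algebra.
Set Implicit Arguments.
Unset Strict Implicit.
Unset Printing Implicit Defensive.

Import GRing.Theory Num.Theory.

Record sgraph := SGraph {
  vertex :> finType;
  adj : rel vertex;
  adj_sym : symmetric adj;
  adj_irr : irreflexive adj }.

Arguments adj {G} : rename.

Definition edges (G : sgraph) : {set {set G}} :=
  [set [set x; y] | x in [set: G], y in [set: G] & adj x y].

Definition degree (G : sgraph) (x : G) : nat := #|[set y | adj x y]|.

Definition connected (G : sgraph) : Prop := forall x y : G, connect adj x y.

(* [ucycle adj c] says that [c] lists, without repetition, the vertices of a
   closed walk; walks back and forth along one edge have size 2. *)
Definition acyclic (G : sgraph) : Prop :=
  forall c : seq G, 2 < size c -> ~ ucycle adj c.

(* The graph without vertices is a (degenerate) tree and path under these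
   definitions, so that the one-edge tree is a caterpillar. *)
Definition is_tree (G : sgraph) : Prop := connected G /\ acyclic G.

Definition is_path (G : sgraph) : Prop :=
  exists (m : nat) (h : 'I_m -> G),
    bijective h /\
    forall i j : 'I_m, adj (h i) (h j) = (i.+1 == j :> nat) || (j.+1 == i :> nat).

Definition has_walk (G : sgraph) (x y : G) (n : nat) : bool :=
  [exists t : n.-tuple G, path adj x t && (last x t == y)].

(* Least length of a walk from [x] to [y]; the value is #|G| when there is
   none, as a shortest walk has fewer than #|G| edges. *)
Definition dist (G : sgraph) (x y : G) : nat :=
  find (has_walk x y) (iota 0 #|G|).

Definition diameter (G : sgraph) : nat := \max_(x : G) \max_(y : G) dist x y.

Section RemoveLeaves.
Variable G : sgraph.

Definition inner := {x : G | degree x != 1}.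
Definition inner_adj : rel inner := fun x y => adj (val x) (val y).

Lemma inner_adj_sym : symmetric inner_adj.
Proof. by move=> x y; apply: adj_sym. Qed.

Lemma inner_adj_irr : irreflexive inner_adj.
Proof. by move=> x; apply: adj_irr. Qed.

Definition remove_leaves : sgraph := SGraph inner_adj_sym inner_adj_irr.

End RemoveLeaves.

Definition is_caterpillar (G : sgraph) : Prop :=
  is_tree G /\ is_path (remove_leaves G).

Definition is_lobster (G : sgraph) : Prop :=
  is_tree G /\ is_caterpillar (remove_leaves G).

(* {0, ±1, ..., ±(m-1)/2} if m is odd, {±1, ..., ±m/2} if m is even. *)
Definition seg_labels (m : nat) : pred int :=
  fun z => if odd m then (`|z| <= m.-1./2)%N else (0 < `|z| <= m./2)%N.

Definition bij_onto (T : finType) (A : {set T}) (g : T -> int) (L : pred int) :=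
  [/\ {in A &, injective g},
      forall x, x \in A -> L (g x)
    & forall z, L z -> exists2 x, x \in A & g x = z].

(* [f] is defined on all sets of vertices, but only its values on [edges G]
   are constrained or used. *)
Definition induced_label (G : sgraph) (f : {set G} -> int) (v : G) : int :=
  (\sum_(u : G | adj u v) f [set u; v])%R.

Definition super_edge_graceful (G : sgraph) : Prop :=
  exists f : {set G} -> int,
    bij_onto (edges G) f (seg_labels #|edges G|) /\
    bij_onto [set: G] (induced_label f) (seg_labels #|G|).

Section RootedTree.
Variables (n : nat) (a : 'I_n -> nat).

(* [None] is the root v_0, [Some (i; None)] its child v_i, and
   [Some (i; Some s)] the s-th child of v_i. *)
Definition RT_vertex := option {i : 'I_n & option 'I_(a i)}.

Definition RT_parent (x y : RT_vertex) : bool :=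
  match x, y with
  | None, Some (existT _ None) => true
  | Some (existT i None), Some (existT i' (Some _)) => i == i'
  | _, _ => false
  end.

Definition RT_adj : rel RT_vertex := fun x y => RT_parent x y || RT_parent y x.

Lemma RT_adj_sym : symmetric RT_adj.
Proof. by move=> x y; rewrite /RT_adj orbC. Qed.

Lemma RT_adj_irr : irreflexive RT_adj.
Proof. by case=> [[i [s|]]|]. Qed.

Definition RT : sgraph := SGraph RT_adj_sym RT_adj_irr.

End RootedTree.

(* Main.v *)
(* Leaves carry the label of their only edge, so it is enough that the root and
   its children v_i together receive 0 and the labels of the edges at the root.
   Pairs {d, -d} of leaf labels at v_i cancel, which reduces each a_i to its
   parity.  The a_i that are even (possibly 0) are even in number, and the
   edges to these v_i take labels c, -c, which they pass on to v_i.  If v_i has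
   a single leaf, its label is the difference between the label of v_i and that
   of the edge to v_i; so 2t vertices v_i with one leaf call for a permutation
   of the odd numbers in [-2t, 2t] whose displacements are the nonzero even
   numbers in [-2t, 2t].  One further v_i with a single leaf takes l on its edge
   and -l on its leaf: then v_i gets 0, and the root gets l. *)
Require Import Defs.
From mathcomp Require Import all_boot all_algebra zify.
Import GRing.Theory.

(** * Rearrangements of 1, ..., t and the permutation of the odd numbers *)

Lemma perm_eq_map_iota (f : nat -> nat) (t : nat) :
  (forall p, 0 < p <= t -> 0 < f p <= t) ->
  (forall p q, 0 < p <= t -> 0 < q <= t -> f p = f q -> p = q) ->
  perm_eq (map f (iota 1 t)) (iota 1 t).
Proof.
move=> f_range f_inj.
have f_uniq : uniq (map f (iota 1 t)).
  rewrite map_inj_in_uniq ?iota_uniq // => p q; rewrite !mem_iota => hp hq.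
  by apply: f_inj; lia.
have f_sub : {subset map f (iota 1 t) <= iota 1 t}.
  move=> _ /mapP[p + ->]; rewrite !mem_iota => hp.
  by have := f_range p; lia.
apply: uniq_perm; rewrite ?iota_uniq //.
by have [] := uniq_min_size f_uniq f_sub; rewrite ?size_map.
Qed.

Lemma perm_odd_even (t : nat) :
  perm_eq ([seq p.*2.-1 | p <- iota 1 t] ++ [seq p.*2 | p <- iota 1 t])
          (iota 1 t.*2).
Proof.
apply: uniq_perm; rewrite ?iota_uniq ?cat_uniq //.
  rewrite !map_inj_in_uniq ?iota_uniq //=; last 2 first.
  - by move=> p q _ _; lia.
  - by move=> p q; rewrite !mem_iota; lia.
  rewrite andbT; apply/hasPn => _ /mapP[p hp ->]; apply/mapP => -[q].
  by move: hp; rewrite !mem_iota; lia.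
move=> m; rewrite mem_cat mem_iota; apply/orP/idP => [[]/mapP[p]|hm].
- by rewrite mem_iota; lia.
- by rewrite mem_iota; lia.
(* Both 2p - 1 and 2p have [uphalf] equal to p. *)
have [om|em] := boolP (odd m); [left|right]; apply/mapP; exists (uphalf m).
all: by rewrite ?mem_iota; lia.
Qed.

(* The permutation of the odd numbers sends [2 p - 1] to [2 q - 1], or to its
   opposite when [core_flip t p], where [q = core_perm t p], and commutes with
   negation.  Half the displacement is [|p - q|], or [p + q - 1] when flipped.
   Without flips, the halves for [p = 2, ..., t] are [1, ..., t - 1] in some
   order, and only [t] is missing.  At [p = 1] the half is [t./2], or
   [t./2 + 1] when flipped; for [t > 1], exactly one of these two also occurs at
   some [p > uphalf t], where [core_perm t p] is [t + 1 - p].  That one is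
   chosen at [1], and flipping at [p] then gives [t].  For [t = 1], the flip at
   [1] gives [t] at once. *)
Definition core_perm (t p : nat) : nat :=
  if p == 1 then t./2.+1
  else if p <= uphalf t then t.+2 - p else t.+1 - p.

Definition core_flip (t p : nat) : bool :=
  if p == 1 then ~~ odd (t./2 + t) || (t == 1)
  else p.*2 == t.+1 + (t./2 + ~~ odd (t./2 + t)).

(** Half the displacement in closed form. A flip at p > 1 occurs only beyond [uphalf t], where it
    gives p + (t + 1 - p) - 1 = t. *)
Definition core_diff (t p : nat) : nat :=
  if p == 1 then t./2 + core_flip t p
  else if core_flip t p then t
  else if p <= uphalf t then t.+2 - p.*2 else p.*2 - t.+1.

Lemma perm_core_perm (t : nat) :
  perm_eq (map (core_perm t) (iota 1 t)) (iota 1 t).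
Proof.
apply: perm_eq_map_iota; rewrite /core_perm.
  by move=> p; do 2?case: ifP; lia.
by move=> p q; do 4?case: ifP; lia.
Qed.

Lemma perm_core_diff (t : nat) :
  perm_eq (map (core_diff t) (iota 1 t)) (iota 1 t).
Proof.
apply: perm_eq_map_iota; rewrite /core_diff /core_flip.
  by move=> p; do 4?case: ifP; lia.
by move=> p q; do 8?case: ifP; lia.
Qed.

(** * Lists of labels closed under negation *)

Local Open Scope ring_scope.

Definition signed_pairs (s : seq int) : seq int := s ++ map -%R s.

Definition signed_labels (N : nat) : seq int :=
  signed_pairs (map Posz (iota 1 N)).

Lemma sum_signed_pairs (s : seq int) : \sum_(x <- signed_pairs s) x = 0.
Proof. by rewrite big_cat big_map /= sumrN subrr. Qed.

Lemma signed_pairs_cat (s1 s2 : seq int) :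
  perm_eq (signed_pairs (s1 ++ s2)) (signed_pairs s1 ++ signed_pairs s2).
Proof. by apply/permP => P; rewrite /signed_pairs map_cat !count_cat; lia. Qed.

(** The pair x, -x does not depend on the sign of x, so the signs set by [core_flip] can be
    ignored. *)
Lemma perm_signed_pairs_abs (s : seq int) (s' : seq nat) :
  perm_eq (map absz s) s' ->
  perm_eq (signed_pairs s) (signed_pairs (map Posz s')).
Proof.
move=> s_s'.
apply: (@perm_trans _ (signed_pairs (map Posz (map absz s)))); last first.
  by apply: perm_cat; do ?apply: perm_map.
apply/permP => P; rewrite /signed_pairs !count_cat.
elim: s {s_s'} => //= x s IHs.
rewrite addnACA IHs [RHS]addnACA; congr addn.
by case: (intP x) => // n; rewrite opprK abszN addnC.
Qed.

Definition core_image (t p : nat) : int :=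
  let v := Posz (core_perm t p).*2.-1 in if core_flip t p then - v else v.

Lemma absz_core_image (t p : nat) :
  absz (core_image t p) = (core_perm t p).*2.-1.
Proof. by rewrite /core_image; case: ifP; rewrite ?abszN. Qed.

Lemma absz_core_image_sub (t p : nat) : (0 < p <= t)%N ->
  absz (core_image t p - Posz p.*2.-1) = (core_diff t p).*2.
Proof.
rewrite /core_image /core_diff /core_perm /core_flip.
by case: eqP => [->|p1]; do 2?case: ifP; lia.
Qed.

(** A pair (c, x) labels the edge to some [v_i] and its single leaf edge. Here c runs over the odd
    numbers and x is the displacement of c, so c + x is the image of c. *)
Lemma core_pairs (t : nat) : exists s : seq (int * int),
  [/\ size s = t.*2,
      perm_eq (unzip1 s ++ unzip2 s) (signed_labels t.*2),
      perm_eq [seq p.1 + p.2 | p <- s] (unzip1 s)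
    & \sum_(p <- s) p.1 = 0].
Proof.
pose c p := Posz p.*2.-1; pose x p := core_image t p - c p.
pose s := [seq (c p, x p) | p <- iota 1 t].
pose ns := [seq (- p.1, - p.2) | p <- s].
have E1 : unzip1 (s ++ ns) = signed_pairs (map c (iota 1 t)).
  by rewrite /signed_pairs /unzip1 map_cat -!map_comp.
have E2 : unzip2 (s ++ ns) = signed_pairs (map x (iota 1 t)).
  by rewrite /signed_pairs /unzip2 map_cat -!map_comp.
have E3 : [seq p.1 + p.2 | p <- s ++ ns]
          = signed_pairs (map (core_image t) (iota 1 t)).
  rewrite /signed_pairs map_cat -!map_comp; congr cat; apply: eq_map => p /=.
    by rewrite addrC subrK.
  by rewrite -opprD addrC subrK.
have P1 : perm_eq (signed_pairs (map c (iota 1 t)))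
    (signed_pairs (map Posz [seq p.*2.-1 | p <- iota 1 t])).
  by rewrite -map_comp.
have P2 : perm_eq (signed_pairs (map x (iota 1 t)))
    (signed_pairs (map Posz [seq p.*2 | p <- iota 1 t])).
  apply: perm_signed_pairs_abs; rewrite -map_comp.
  rewrite (@eq_in_map _ _ _ (fun p => (core_diff t p).*2) _).1 => [|p].
    by rewrite (map_comp double); apply/perm_map/perm_core_diff.
  by rewrite mem_iota => hp; apply: absz_core_image_sub; lia.
have P3 : perm_eq (signed_pairs (map (core_image t) (iota 1 t)))
    (signed_pairs (map c (iota 1 t))).
  rewrite (map_comp Posz); apply: perm_signed_pairs_abs; rewrite -map_comp.
  rewrite (eq_map (absz_core_image t)) (map_comp (fun p => p.*2.-1)).
  exact/perm_map/perm_core_perm.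
exists (s ++ ns); split; rewrite ?E3 ?E1 ?E2 //; last 1 first.
- rewrite -(big_map fst xpredT id) -/(unzip1 _) E1.
  exact: sum_signed_pairs.
- by rewrite size_cat !size_map size_iota addnn.
- apply: perm_trans (perm_cat P1 P2) _.
  rewrite perm_sym; apply: perm_trans (signed_pairs_cat _ _).
  rewrite perm_sym -map_cat.
  by apply: perm_cat; do ?apply: perm_map; apply: perm_odd_even.
Qed.

(** * Labellings as blocks, one for each child of the root *)

(* The label of the edge from the root to some [v_i], and those of the edges
   from [v_i] to its leaves. *)
Definition block : Type := int * seq int.

Definition block_labels (b : block) : seq int := b.1 :: b.2.

Definition block_sum (b : block) : int := \sum_(x <- block_labels b) x.

(** Leaves repeat the labels of their edges, so only the root and its children are compared with the
    root edges; 0 is the one vertex label that is no edge label. *)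
Definition graceful_blocks (N : nat) (bs : seq block) : Prop :=
  perm_eq (flatten (map block_labels bs)) (signed_labels N) /\
  perm_eq (\sum_(b <- bs) b.1 :: map block_sum bs) (0 :: unzip1 bs).

Lemma block_sum_cons (e : int) (xs : seq int) :
  block_sum (e, xs) = e + \sum_(x <- xs) x.
Proof. by rewrite /block_sum big_cons. Qed.

(** Lets blocks built with the one-leaf ones first be reordered to follow the given order of the
    [a_i]. *)
Lemma perm_eq_map_preim (T1 T2 : eqType) (f : T1 -> T2) (s1 : seq T1)
    (s2 : seq T2) :
  perm_eq s2 (map f s1) -> exists2 s1', perm_eq s1' s1 & map f s1' = s2.
Proof.
case: s1 => [/perm_nilP ->|x0 s1]; first by exists [::].
case/(perm_iotaP (f x0)) => Is; rewrite size_map => hIs ->.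
exists [seq nth x0 (x0 :: s1) i | i <- Is].
  by apply/(perm_iotaP x0); exists Is.
rewrite -map_comp; apply/eq_in_map => i hi /=.
have hi' : (i < size (x0 :: s1))%N.
  by have := perm_mem hIs i; rewrite hi mem_iota.
by rewrite (nth_map x0 _ f hi').
Qed.

Lemma graceful_blocks_perm (N : nat) (bs bs' : seq block) :
  perm_eq bs' bs -> graceful_blocks N bs -> graceful_blocks N bs'.
Proof.
move=> bs_bs' [labels sums]; split.
  by apply: perm_trans labels; apply/perm_flatten/perm_map.
rewrite (perm_big _ bs_bs') /=; apply: (perm_trans (y := 0 :: unzip1 bs)).
  by apply: perm_trans sums; rewrite perm_cons; apply: perm_map.
by rewrite perm_cons perm_sym; apply: perm_map.
Qed.

(** [d] is cut into pieces of lengths [m./2]; each piece joins the leaf labels of its block together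
    with its negatives, which keeps the block sum. *)
Lemma pad_blocks (sizes : seq nat) (bs : seq block) (d : seq int) :
    [seq size b.2 | b <- bs] = [seq nat_of_bool (odd m) | m <- sizes] ->
    size d = sumn (map half sizes) ->
  exists bs', [/\ [seq size b.2 | b <- bs'] = sizes, unzip1 bs' = unzip1 bs,
    map block_sum bs' = map block_sum bs
    & perm_eq (flatten (map block_labels bs'))
              (flatten (map block_labels bs) ++ signed_pairs d)].
Proof.
elim: sizes bs d => [|m sizes IHs] [|[e xs] bs] d //=.
  by move=> _ /size0nil ->; exists [::].
case=> size_xs size_bs size_d.
have [||bs' [size_bs' e_bs' sum_bs' labels_bs']] := IHs bs (drop m./2 d) => //.
  by rewrite size_drop size_d addKn.
set d1 := take m./2 d.
have size_d1 : size d1 = m./2 by rewrite size_takel // size_d leq_addr.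
exists ((e, xs ++ signed_pairs d1) :: bs'); split=> /=.
- congr cons => //; rewrite size_cat size_xs size_cat size_map size_d1.
  by rewrite addnn odd_double_half.
- by rewrite e_bs'.
- by rewrite sum_bs' !block_sum_cons big_cat /= sum_signed_pairs addr0.
rewrite perm_cons; apply/permP => P; have /permP/(_ P) := labels_bs'.
rewrite /signed_pairs -[in X in _ -> _ = X](cat_take_drop m./2 d) -/d1.
by rewrite map_cat !count_cat; lia.
Qed.

Lemma graceful_blocks_pad (N : nat) (sizes : seq nat) (bs : seq block) :
    [seq size b.2 | b <- bs] = [seq nat_of_bool (odd m) | m <- sizes] ->
    graceful_blocks N bs ->
  exists2 bs', [seq size b.2 | b <- bs'] = sizes &
    graceful_blocks (N + sumn (map half sizes)) bs'.
Proof.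
move=> size_bs [labels sums].
have size_d := size_iota N.+1 (sumn (map half sizes)).
rewrite -(size_map Posz) in size_d.
have [bs' [size_bs' e_bs' sum_bs' labels_bs']] :=
  pad_blocks _ _ _ size_bs size_d.
exists bs' => //; split.
  apply: perm_trans labels_bs' _.
  apply: perm_trans (perm_cat labels (perm_refl _)) _.
  by rewrite perm_sym /signed_labels iotaD map_cat; apply: signed_pairs_cat.
by rewrite -(big_map fst xpredT id) -/(unzip1 _) e_bs' sum_bs' big_map.
Qed.

(** Absolute values are shared out in order: up to [l./2.*2] to the core, then l to [extra] if l is
    odd, then l + 1, ..., l + w to the leafless blocks. *)
Lemma graceful_blocks_unit (l w : nat) :
  exists2 bs, [seq size b.2 | b <- bs] = nseq l 1 ++ nseq w.*2 0 &
    graceful_blocks (l + w) bs.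
Proof.
have [s [size_s labels_s sums_s sum_s]] := core_pairs l./2.
pose core : seq block := [seq (p.1, [:: p.2]) | p <- s].
(* This block has sum 0 and raises the root from 0 to l, so the two merely exchange the labels 0 and
   l. *)
pose extra : seq block := if odd l then [:: (Posz l, [:: - Posz l])] else [::].
pose c := [seq Posz p | p <- iota l.+1 w].
pose zero : seq block := [seq (x, [::]) | x <- signed_pairs c].
have e_core : unzip1 core = unzip1 s by rewrite /unzip1 -map_comp.
have e_zero : unzip1 zero = signed_pairs c by rewrite /unzip1 -map_comp map_id.
have sum_core : map block_sum core = [seq p.1 + p.2 | p <- s].
  by rewrite -map_comp; apply: eq_map => p /=; rewrite block_sum_cons big_seq1.
have sum_zero : map block_sum zero = signed_pairs c.
  rewrite -map_comp -[RHS]map_id; apply: eq_map => x /=.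
  by rewrite block_sum_cons big_nil addr0.
have size_core : [seq size b.2 | b <- core] = nseq l./2.*2 1.
  by rewrite -map_comp -size_s; elim: (s) => //= p s' ->.
have size_zero : [seq size b.2 | b <- zero] = nseq w.*2 0.
  have <- : size (signed_pairs c) = w.*2.
    by rewrite size_cat !size_map size_iota addnn.
  by rewrite -map_comp; elim: (signed_pairs c) => //= x s' ->.
exists (core ++ extra ++ zero).
  rewrite !map_cat size_core size_zero catA; congr cat.
  rewrite /extra -[in RHS](odd_double_half l).
  by case: (odd l); rewrite ?cats0 // addnC nseqD.
have labels_core :
    perm_eq (flatten (map block_labels core)) (signed_labels l./2.*2).
  apply: perm_trans labels_s; apply/permP => P; rewrite count_cat /core.
  by elim: (s) => //= p s' ->; lia.
have labels_zero : flatten (map block_labels zero) = signed_pairs c.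
  by rewrite -map_comp; apply: flatten_seq1.
have labels_core_extra :
    perm_eq (flatten (map block_labels core) ++
             flatten (map block_labels extra))
            (signed_labels l).
  apply: perm_trans (perm_cat labels_core (perm_refl _)) _; rewrite perm_sym.
  rewrite /signed_labels -[in iota 1 l](odd_double_half l) addnC iotaD map_cat.
  apply: perm_trans (signed_pairs_cat _ _) _; rewrite perm_cat2l /extra.
  by case odd_l: (odd l) => //=; rewrite (_ : 1 + l./2.*2 = l)%N //; lia.
split.
  rewrite !map_cat !flatten_cat labels_zero (catA (flatten _)).
  apply: perm_trans (perm_cat labels_core_extra (perm_refl _)) _.
  rewrite perm_sym /signed_labels iotaD map_cat; exact: signed_pairs_cat.
have sum_core0 : \sum_(b <- core) b.1 = 0 by rewrite big_map.
have sum_zero0 : \sum_(b <- zero) b.1 = 0 by rewrite big_map sum_signed_pairs.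
rewrite !big_cat /= sum_core0 sum_zero0 add0r addr0 /unzip1 !map_cat.
rewrite -!/(unzip1 _) e_core e_zero sum_core sum_zero /extra.
apply/permP => P; move/permP/(_ P): sums_s => /=; rewrite !count_cat => ->.
case: (odd l); rewrite ?big_nil //= big_seq1 block_sum_cons big_seq1 subrr /=.
by rewrite !addn0 addnCA [in RHS]addnCA; congr addn; rewrite addnCA.
Qed.

Lemma graceful_blocks_exist (sizes : seq nat) :
    ~~ odd (size sizes + sumn sizes) ->
  exists2 bs, [seq size b.2 | b <- bs] = sizes &
    graceful_blocks (size sizes + sumn sizes)./2 bs.
Proof.
move=> even_q.
(* [sumn sizes] has the parity of l, so [even_q] makes [size sizes - l] even and the halving
   exact. *)
pose l := count odd sizes; pose w := (size sizes - l)./2.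
have size_l := count_predC odd sizes.
have sum_half : sumn sizes = (l + (sumn (map half sizes)).*2)%N.
  rewrite /l; elim: (sizes) => //= m s ->; have := odd_double_half m; lia.
have [bs0 size_bs0 graceful_bs0] := graceful_blocks_unit l w.
have : perm_eq [seq nat_of_bool (odd m) | m <- sizes] [seq size b.2 | b <- bs0].
  have -> : [seq size b.2 | b <- bs0] =
      nseq (count odd sizes) 1 ++ nseq (count (predC odd) sizes) 0.
    rewrite size_bs0; congr (_ ++ nseq _ _); rewrite /w /l; lia.
  apply/permP => P; rewrite count_cat !count_nseq.
  elim: (sizes) => [|m s /= ->]; first by rewrite !muln0.
  by case: (odd m); rewrite ?add0n ?add1n mulnS ?addnA // [(_ + P _)%N]addnC.
case/perm_eq_map_preim => bs1 bs1_bs0 size_bs1.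
have [bs size_bs graceful_bs] :=
  graceful_blocks_pad _ _ _ size_bs1
    (graceful_blocks_perm _ _ _ bs1_bs0 graceful_bs0).
exists bs => //.
have <- : (l + w + sumn (map half sizes))%N = (size sizes + sumn sizes)./2.
  by rewrite /w; lia.
by [].
Qed.

(** * From rearranged lists to bijections *)

Lemma uniq_signed_labels (N : nat) : uniq (signed_labels N).
Proof.
rewrite cat_uniq !map_inj_uniq ?iota_uniq //=; try by move=> p q; lia.
rewrite andbT; apply/hasPn => _ /mapP[_ /mapP[p + ->] ->].
by rewrite mem_iota => hp; apply/mapP => -[q]; lia.
Qed.

Lemma mem_signed_labels (N : nat) (z : int) :
  (z \in signed_labels N) = (0 < `|z| <= N)%N.
Proof.
rewrite mem_cat; apply/orP/idP => [[]/mapP[p]|hz].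
- by rewrite mem_iota => hp ->; lia.
- by case/mapP => q; rewrite mem_iota => hq -> ->; lia.
case: z hz => m hm; [left|right].
  by apply/mapP; exists m => //; rewrite mem_iota; lia.
apply/mapP; exists (Posz m.+1); last by rewrite NegzE.
by apply/mapP; exists m.+1 => //; rewrite mem_iota; lia.
Qed.

(** Reduces bijectivity to an equality of lists up to order, which can be checked by counting. *)
Lemma bij_onto_perm (T : finType) (A : {set T}) (g : T -> int) (L : pred int)
    (s : seq int) :
  uniq s -> s =i L -> perm_eq (map g (enum A)) s -> bij_onto A g L.
Proof.
move=> s_uniq sL gA_s; have g_mem := perm_mem gA_s; split.
- by apply/dinjectiveP; rewrite /dinjectiveb (perm_uniq gA_s).
- by move=> x xA; rewrite -[L _]sL -g_mem map_f ?mem_enum.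
move=> z; rewrite -[L _]sL -g_mem => /mapP[x]; rewrite mem_enum => xA ->.
by exists x.
Qed.

Lemma count_map_enum (T : finType) (U : Type) (g : T -> U) (P : pred U) :
  count P (map g (enum T)) = (\sum_t P (g t))%N.
Proof.
rewrite count_map -sum1_count big_enum_cond /= big_mkcond.
by apply: eq_bigr => t _; case: (P _).
Qed.

Lemma count_sum_nth (U : Type) (x0 : U) (s : seq U) (n : nat) (P : pred U) :
  size s = n -> count P s = (\sum_(i < n) P (nth x0 s i))%N.
Proof.
move=> <-; rewrite -sum1_count big_mkcond (big_nth x0) big_mkord.
by apply: eq_bigr => i _; case: (P _).
Qed.

Lemma big_option (R : Type) (idx : R) (op : Monoid.com_law idx) (T : finType)
    (F : option T -> R) :
  \big[op/idx]_o F o = op (F None) (\big[op/idx]_t F (Some t)).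
Proof.
rewrite (bigD1 None) //=; congr (op _ _).
rewrite (reindex_omap Some id) => [|[]//].
by apply: eq_bigl => t; rewrite /= eqxx.
Qed.

(** * Edges and induced labels of the rooted tree *)

Section Labelling.
Variables (n : nat) (a : 'I_n -> nat).

(** The non-root vertices, which also index the edges. *)
Definition RT_child : finType := {i : 'I_n & option 'I_(a i)}.

Definition parent (y : RT_child) : RT a :=
  if y is existT i (Some _) then Some (existT _ i None) else None.

Definition parent_edge (y : RT_child) : {set RT a} := [set Some y; parent y].

Lemma big_RT_child (R : Type) (idx : R) (op : Monoid.com_law idx)
    (F : RT_child -> R) :
  \big[op/idx]_y F y =
  \big[op/idx]_i op (F (existT _ i None))
                    (\big[op/idx]_s F (existT _ i (Some s))).
Proof.
transitivity
  (\big[op/idx]_i \big[op/idx]_(o : option 'I_(a i)) F (existT _ i o)).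
  by rewrite sig_big_dep; apply: eq_bigr => -[].
by apply: eq_bigr => i _; rewrite big_option.
Qed.

Lemma RT_parentE (u v : RT a) :
  RT_parent u v = if v is Some y then u == parent y else false.
Proof.
case: v => [[i [s|]]|]; case: u => [[j [r|]]|] //=; last first.
  by apply/eqP/eqP => [->//|[]].
by apply/esym/eqP.
Qed.

Lemma RT_parent_asym (u v : RT a) : RT_parent u v -> ~~ RT_parent v u.
Proof. by case: u v => [[i [s|]]|] [[j [r|]]|]. Qed.

(** If distinct y and z had the same edge, each would be the parent of the other. *)
Lemma parent_edge_inj : injective parent_edge.
Proof.
move=> y z yz; have := set21 (Some y : RT a) (parent y).
rewrite -/(parent_edge y) yz in_set2 => /orP[/eqP[]//|/eqP y_pz].
have := set21 (Some z : RT a) (parent z).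
rewrite -/(parent_edge z) -yz in_set2 => /orP[/eqP[]//|/eqP z_py].
have := @RT_parent_asym (Some y) (Some z).
by rewrite !RT_parentE y_pz -z_py !eqxx => /(_ isT).
Qed.

Lemma edges_RT : edges (RT a) = parent_edge @: [set: RT_child].
Proof.
apply/setP => S; apply/imset2P/imsetP => [[u v _]|[y _ ->]].
  rewrite !inE /= /RT_adj !RT_parentE => /orP[].
    by case: v => // y /eqP -> ->; exists y; [rewrite inE | apply: setUC].
  by case: u => // y /eqP -> ->; exists y; [rewrite inE |].
exists (Some y) (parent y) => //.
by rewrite !inE /= /RT_adj !RT_parentE eqxx orbT.
Qed.

Variable g : RT_child -> int.

(** The sum has at most one term, as [parent_edge] is injective; it carries [g] over to edges
    without an inverse map. *)
Definition edge_labelling (S : {set RT a}) : int :=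
  \sum_(y | parent_edge y == S) g y.

Lemma edge_labellingE (y : RT_child) : edge_labelling (parent_edge y) = g y.
Proof. by apply: big_pred1 => z; rewrite (inj_eq parent_edge_inj). Qed.

Lemma induced_labelE (v : RT a) : induced_label edge_labelling v =
  (if v is Some y then g y else 0) + \sum_(y | parent y == v) g y.
Proof.
rewrite /induced_label big_mkcond /=.
pose F u := edge_labelling [set u; v].
(* A neighbour of v is either its parent or its child, never both, so the sum splits. *)
rewrite (eq_bigr (fun u => (if RT_parent u v then F u else 0)
                         + (if RT_parent v u then F u else 0))); last first.
  move=> u _; rewrite /RT_adj; have := @RT_parent_asym u v.
  by case: (RT_parent u v) => [/(_ isT)/negPf->|_]; rewrite ?addr0 ?add0r.
rewrite big_split /=; congr (_ + _); rewrite -big_mkcond /=.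
  case: v @F => [y|] F; last by rewrite big_pred0 // => u; rewrite RT_parentE.
  rewrite (big_pred1 (parent y)) => [|u]; last by rewrite RT_parentE.
  by rewrite /F setUC -/(parent_edge y) edge_labellingE.
rewrite big_mkcond big_option RT_parentE /= add0r [RHS]big_mkcond.
apply: eq_bigr => y _.
rewrite RT_parentE eq_sym /F; case: eqP => // <-.
by rewrite -/(parent_edge y) edge_labellingE.
Qed.

End Labelling.

Arguments RT_child {n} a.
Arguments parent {n a} y.
Arguments parent_edge {n a} y.
Arguments edge_labelling {n a} g S.

Lemma children_rootE (n : nat) (a : 'I_n -> nat) (F : RT_child a -> int) :
  \sum_(y | parent y == None) F y = \sum_i F (existT _ i None).
Proof.
rewrite big_mkcond big_RT_child; apply: eq_bigr => i _ /=.
by rewrite big1 ?addr0.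
Qed.

Lemma eq_RT_inner (n : nat) (a : 'I_n -> nat) (i j : 'I_n) :
  (Some (existT _ j None) == Some (existT _ i None) :> RT a) = (j == i).
Proof. by apply/eqP/eqP => [[]|->]. Qed.

Lemma children_innerE (n : nat) (a : 'I_n -> nat) (F : RT_child a -> int)
    (i : 'I_n) :
  \sum_(y | parent y == Some (existT _ i None)) F y
  = \sum_s F (existT _ i (Some s)).
Proof.
rewrite big_mkcond big_RT_child (bigD1 i) //= add0r [X in _ + X]big1 ?addr0.
  by apply: eq_bigr => s _; rewrite eqxx.
move=> j ji; rewrite add0r big1 // => s _.
by rewrite eq_RT_inner (negPf ji).
Qed.

Lemma children_leafE (n : nat) (a : 'I_n -> nat) (F : RT_child a -> int)
    (i : 'I_n) (s : 'I_(a i)) :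
  \sum_(y | parent y == Some (existT _ i (Some s))) F y = 0.
Proof.
(* A parent is never a leaf; a boolean test avoids inverting an equality of dependent pairs. *)
pose is_leaf (v : RT a) := if v is Some (existT _ o) then isSome o else false.
by apply: big_pred0 => -[j [r|]] //; apply/negP => /eqP/(congr1 is_leaf).
Qed.

(** * Transfer of the blocks to the tree *)

Lemma RT_super_edge_graceful (n : nat) (a : 'I_n -> nat) :
  ~~ odd #|edges (RT a)| -> super_edge_graceful (RT a).
Proof.
move=> even_edges.
pose sizes := map a (enum 'I_n).
have card_child : #|RT_child a| = (size sizes + sumn sizes)%N.
  rewrite -sum1_card big_RT_child big_split /= sum1_card card_ord.
  rewrite size_map size_enum_ord sumnE big_map big_enum /=; congr addn.
  by apply: eq_bigr => i _; rewrite sum1_card card_ord.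
have card_edges : #|edges (RT a)| = #|RT_child a|.
  by rewrite edges_RT card_imset ?cardsT //; apply: parent_edge_inj.
have even_q : ~~ odd (size sizes + sumn sizes).
  by rewrite -card_child -card_edges.
have [bs size_bs [labels_bs sums_bs]] := graceful_blocks_exist _ even_q.
move: labels_bs; set N := (_./2) => labels_bs.
have card_bs : size bs = n.
  by rewrite -(size_map (fun b => size b.2)) size_bs size_map size_enum_ord.
pose b i := nth (0, [::]) bs i : block.
have size_b (i : 'I_n) : size (b i).2 = a i.
  rewrite -(nth_map _ 0%N (fun c : block => size c.2)) ?card_bs // size_bs.
  by rewrite (nth_map i) ?size_enum_ord // nth_ord_enum.
(* The default 0 is never reached, since [(b i).2] has [a i] entries. *)
pose g (y : RT_child a) : int :=
  let: existT i o := y in if o is Some s then nth 0 (b i).2 s else (b i).1.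
have big_bs (R : Type) (idx : R) (op : Monoid.com_law idx) (F : block -> R) :
    \big[op/idx]_(c <- bs) F c = \big[op/idx]_(i < n) F (b i).
  by rewrite (big_nth (0, [::])) card_bs big_mkord.
have sum_b (i : 'I_n) :
    block_sum (b i) = (b i).1 + \sum_s g (existT _ i (Some s)).
  rewrite /block_sum big_cons; congr (_ + _).
  by rewrite (big_nth 0) size_b big_mkord.
have count_b (P : pred int) (i : 'I_n) :
    count P (b i).2 = (\sum_s P (g (existT _ i (Some s))))%N.
  exact: count_sum_nth.
have count_g (P : pred int) :
    count P (signed_labels N) = (\sum_y P (g y))%N.
  rewrite -(permP labels_bs) count_flatten sumnE !big_map big_bs big_RT_child.
  by apply: eq_bigr => i _ /=; rewrite count_b.
exists (edge_labelling g); split.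
  apply: (bij_onto_perm _ _ _ _ (signed_labels N)).
  - exact: uniq_signed_labels.
  - move=> z; rewrite mem_signed_labels -topredE /= /seg_labels.
    by rewrite (negPf even_edges) card_edges card_child.
  apply: (perm_trans (y := map g (enum (RT_child a)))).
    have -> : map g (enum (RT_child a))
        = map (edge_labelling g) (map (@parent_edge n a) (enum (RT_child a))).
      by rewrite -map_comp; apply: eq_map => y /=; rewrite edge_labellingE.
    apply/perm_map/uniq_perm; rewrite ?enum_uniq //.
      by rewrite map_inj_uniq ?enum_uniq //; apply: parent_edge_inj.
    move=> S; rewrite mem_enum edges_RT; apply/imsetP/mapP => -[y _ ->].
      by exists y; rewrite ?mem_enum.
    by exists y.
  by apply/permP => P; rewrite count_map_enum count_g.
apply: (bij_onto_perm _ _ _ _ (0 :: signed_labels N)).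
- by rewrite /= uniq_signed_labels mem_signed_labels.
(* With q edges there are p = q + 1 vertices; p is odd and (p - 1) / 2 = N, so the vertex labels are
   the edge labels and 0. *)
- move=> z; rewrite inE mem_signed_labels -topredE /= /seg_labels.
  have -> : #|RT a| = #|RT_child a|.+1 by rewrite card_option.
  rewrite /= -card_edges (negPf even_edges) /= card_edges card_child -/N.
  by case: z => // -[].
rewrite enum_setT -enumT.
apply/permP => P; rewrite count_map_enum big_option big_RT_child /=.
have count_bs (h : block -> int) :
    count P (map h bs) = (\sum_(i < n) P (h (b i)))%N.
  rewrite count_map -sum1_count big_mkcond big_bs.
  by apply: eq_bigr => i _ /=; case: (P _).
have /= := permP sums_bs P; rewrite !count_bs big_bs => sums.
(* Leaves count equally on both sides; [sums] settles the root and its children. *)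
rewrite induced_labelE add0r children_rootE count_g big_RT_child.
rewrite !big_split /= !addnA -sums; congr (_ + _ + _)%N.
  apply: eq_bigr => i _; rewrite induced_labelE children_innerE.
  by rewrite sum_b.
apply: eq_bigr => i _; apply: eq_bigr => s _.
by rewrite induced_labelE children_leafE addr0.
Qed.

Local Close Scope ring_scope.

Theorem theorem3 (n : nat) (a : 'I_n -> nat)
  (hdiam : diameter (RT a) = 4)
  (hlobster : is_lobster (RT a))
  (hpos : 3 <= #|[set i : 'I_n | 0 < a i]|)
  (heven : ~~ odd #|edges (RT a)|) :
  super_edge_graceful (RT a).
Proof. exact: RT_super_edge_graceful. Qed.
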